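(* Let $G$ be a torsion-free Abelian group of cardinality $\mathfrak c$, endowed with the topology $\tau_G$ described in the context. If $A\subseteq G$ is infinite, then its closure $\overline A$ in $(G,\tau_G)$ satisfies $|\overline A|=\mathfrak c$. Consequently, every infinite closed subset of $(G,\tau_G)$ has cardinality $\mathfrak c$.
   Context: Notation. $\mathbb N=\{0,1,2,\dots\}$; $\mathfrak c=2^{\aleph_0}$ is regarded as an initial ordinal, and each ordinal is the set of smaller ordinals. $\mathbb T=\mathbb R/\mathbb Z$ with $\|x+\mathbb Z\|=\min_{n\in\mathbb Z}|x-n|$. $\mathbb Q^{(\mathfrak c)}$ is the group of functions $z:\mathfrak c\to\mathbb Q$ with finite support $\operatorname{supp}(z)=\{\xi<\mathfrak c: z(\xi)\ne0\}$; $\mathbb Z^{(\mathfrak c)}$ is its subgroup of integer-valued functions; $e_\xi$ is the function equal to $1$ at $\xi$ and $0$ elsewhere. For an ultrafilter $p$ on $\mathbb N$, $p\text{-}\lim_n x_n=x$ means $\{n:x_n\in U\}\in p$ for every neighborhood $U$ of $x$. Independence and relations. For an Abelian group $H$ and $M\in\mathbb N$, a finite set $X\subseteq H$ is $M$-independent if the only $c\in\mathbb Z^X$ with $\sum_{x\in X}c_x x=0$ and $|c_x|\le M$ for all $x\in X$ is $c=0$. For finite $A,Y\subseteq H$, a mixed relation of height at most $Q$ between $A$ and $Y$ is a pair $(b,c)\in\mathbb Z^A\times\mathbb Z^Y$ with $b\ne0$, $c\neq0$, all coordinates of absolute value at most $Q$, and $\sum_{a\in A}b_a a+\sum_{y\in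 Y}c_y y=0$. Numerical parameters. $N_l=(l+2)\bigl(2l+2+\sum_{j<l}N_j\bigr)$, $S_l=\sum_{j<l}N_j$, $R_l=S_l+2l+2$, $\varepsilon_l=2^{-(l+6)}$, $I_l=\{S_l,S_l+1,\dots,S_l+N_l-1\}$ for $l\in\mathbb N$ (the $I_l$ partition $\mathbb N$). For each $l$ and each positive integer $m\le R_l+N_l$, $q(m,\varepsilon_l)\in\mathbb N$ is a chosen integer such that for every Abelian group $H$, $z\in H^m$, $t\in\mathbb T^m$: if $\sum_{i<m}a_it_i=0$ for every $a\in\mathbb Z^m$ with $\sum_{i<m}a_iz_i=0$ and $\max_i|a_i|\le q(m,\varepsilon_l)$, then some homomorphism $\psi:H\to\mathbb T$ satisfies $\max_{i<m}\|\psi(z_i)-t_i\|<\varepsilon_l$. Put $Q_l=\max(\{1\}\cup\{q(m,\varepsilon_l):1\le m\le R_l+N_l\})$. $M_l\in\mathbb N$ is a chosen integer such that whenever $H$ is a torsion-free Abelian group, $A,X\subseteq H$ are finite, $|A|\le R_l$ and $X$ is $M_l$-independent, there is $Y\subseteq X$ with $|X\setminus Y|\le|A|$ admitting no mixed relation of height at most $Q_l$ between $A$ and $Y$. Sequences. The group $G$ is identified with a subgroup satisfying $\mathbb Z^{(\mathfrak c)}\le G\le\mathbb Q^{(\mathfrak c)}$ (always possible). $(s_\alpha)_{\alpha<\mathfrak c}$ is an enumeration without repetitions of all injective sequences $\mathbb N\to G$. $\iota:\mathfrak c\to\mathfrak c$ is an injection with $\bigcup_{n}\operatorname{supp}s_\alpha(n)\subseteq\iota(\alpha)$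 for all $\alpha$. For each $\alpha<\mathfrak c$, $\varphi_\alpha:\mathbb N\to\mathbb N$ is strictly increasing and $h_\alpha=s_\alpha\circ\varphi_\alpha$ is such that for every $l$ the set $X_{\alpha,l}=\{h_\alpha(n)-e_{\iota(\alpha)}:n\in I_l\}$ has cardinality $N_l$ and is $M_l$-independent, and $\operatorname{supp}h_\alpha(n)\subseteq\iota(\alpha)$ for all $n$. Ultrafilters. $(A_\alpha)_{\alpha<\mathfrak c}$ is a family of infinite subsets of $\mathbb N$ with $A_\alpha\cap A_\beta$ finite for $\alpha\ne\beta$. $\mathscr D_\alpha=\{C\subseteq\mathbb N:\lim_{l\in A_\alpha,\,l\to\infty}|I_l\setminus C|/N_l=0\}$, a free filter, and $p_\alpha$ is a chosen (necessarily free) ultrafilter on $\mathbb N$ with $\mathscr D_\alpha\subseteq p_\alpha$. The topology $\tau_G$. For each $0\ne x\in G$ a homomorphism $\psi_x:G\to\mathbb T$ is chosen such that $\psi_x(x)\ne0$ and $p_\alpha\text{-}\lim_n\psi_x(h_\alpha(n))=\psi_x(e_{\iota(\alpha)})$ for every $\alpha<\mathfrak c$. $\tau_G$ is the initial topology on $G$ induced by the map $\Delta_G:G\to\mathbb T^{G\setminus\{0\}}$, $\Delta_G(z)=(\psi_x(z))_{x\neq0}$. *)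

(* Defs.v *)
From HB Require Import structures.
From mathcomp Require Import all_boot all_order all_algebra finmap.
From mathcomp Require Import all_classical all_reals topology normedtype wochoice.
From mathcomp Require Import lra.
Import Order.TTheory GRing.Theory Num.Theory.
Import numFieldNormedType.Exports.

Set Implicit Arguments.
Unset Strict Implicit.
Unset Printing Implicit Defensive.

Local Open Scope classical_set_scope.
Local Open Scope card_scope.
Local Open Scope ring_scope.

(* The cardinal 2 ^ aleph_0 as an initial ordinal: up to isomorphism, the only
   well-ordered set of that cardinality whose proper initial segments are all
   strictly smaller. *)
Definition continuum_ordinal d (K : orderType d) : Prop :=
  [/\ well_order (<=%O : rel K),
      [set: K] #= [set: nat -> bool]
    & forall xi : K, ~ ([set: K] #<= [set eta : K | (eta < xi)%O])].

Section Circle.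
Local Open Scope quotient_scope.
Variable R : realType.

(* The subgroup of integers of R; [Num.int] is a qualifier over this predicate. *)
Definition integers : zmodClosed R :=
  GRing.ZmodClosed.clone R (@Num.int_num_subdef R) _.

Definition circle : Type := Quotient.quot integers.

HB.instance Definition _ := Choice.on circle.
HB.instance Definition _ := EqQuotient.on circle.
HB.instance Definition _ := GRing.Zmodule.on circle.
HB.instance Definition _ := ZmodQuotient.on circle.

Implicit Types (x y : R) (s t : circle).

(* The infimum is attained, and any representative may be used in place of
   [repr t]: see [cnorm_pi_le] and [cnorm_pi_min]. *)
Definition cnorm t : R := inf (range (fun n : int => `|repr t - n%:~R|)).

Lemma circle_eqP x y :
  reflect (exists n : int, x = y + n%:~R) (\pi_circle x == \pi_circle y).
Proof.
rewrite -[_ == _]/(x == y %[mod Quotient.quot integers]).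
rewrite -Quotient.idealrBE -[_ \in _]/(x - y \is a Num.int).
apply: (iffP (@intrP R (x - y))) => -[n h]; exists n.
  by rewrite -h addrC subrK.
by rewrite h addrC addKr.
Qed.

Let min_dist x : exists n : int, forall m : int, `|x - n%:~R| <= `|x - m%:~R|.
Proof.
set k := Num.floor x.
have kx : k%:~R <= x by rewrite -floor_ge_int.
have xk : x < k%:~R + 1 by have := floorD1_gt x; rewrite intrD.
have mk (m : int) : m%:~R <= k%:~R :> R \/ k%:~R + 1 <= m%:~R :> R.
  have [mk|km] := lerP m k; [left | right]; first by rewrite ler_int.
  by rewrite -[1]/(1%:~R) -intrD ler_int lezD1.
have [h|h] := lerP (x - k%:~R) (k%:~R + 1 - x).
  exists k => m; case: (mk m) => ?.
    by rewrite !ger0_norm; lra.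
  by rewrite ger0_norm ?ler0_norm; lra.
exists (k + 1) => m; rewrite intrD /=; case: (mk m) => ?.
  by rewrite ler0_norm ?ger0_norm; lra.
by rewrite !ler0_norm; lra.
Qed.

Let cnorm_has_lbound x : has_lbound (range (fun n : int => `|x - n%:~R|)).
Proof. by exists 0 => _ [n _ <-]. Qed.

Lemma cnorm_pi x :
  cnorm (\pi_circle x) = inf (range (fun n : int => `|x - n%:~R|)).
Proof.
have /circle_eqP[k xk] : \pi_circle x == \pi_circle (repr (\pi_circle x)).
  by rewrite reprK.
congr inf; apply/seteqP; split=> _ [n _ <-] /=.
  by exists (n + k) => //; rewrite {1}xk intrD; congr `|_|; lra.
by exists (n - k) => //; rewrite [in RHS]xk intrB; congr `|_|; lra.
Qed.

Lemma cnorm_pi_le x (n : int) : cnorm (\pi_circle x) <= `|x - n%:~R|.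
Proof. by rewrite cnorm_pi; apply: ge_inf => //; exists n. Qed.

Lemma cnorm_pi_min x :
  exists n : int, cnorm (\pi_circle x) = `|x - n%:~R|.
Proof.
have [n hn] := min_dist x; exists n; apply/le_anti.
rewrite cnorm_pi_le cnorm_pi lb_le_inf //; first by exists `|x - 0%:~R|, 0.
by move=> _ [m _ <-]; exact: hn.
Qed.

Lemma cnormP t : exists2 x, \pi_circle x = t & cnorm t = `|x|.
Proof.
have [n hn] := cnorm_pi_min (repr t); exists (repr t - n%:~R).
  rewrite -[RHS]reprK; apply/eqP/circle_eqP; exists (- n).
  by rewrite intrN.
by rewrite -hn reprK.
Qed.

Lemma cnorm_le x : cnorm (\pi_circle x) <= `|x|.
Proof. by have := cnorm_pi_le x 0; rewrite subr0. Qed.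

Lemma cnormN t : cnorm (- t) = cnorm t.
Proof.
suff le s : cnorm (- s) <= cnorm s.
  by apply/le_anti; rewrite le -{1}[t]opprK le.
have [x <- ->] := cnormP s; rewrite -normrN.
by rewrite (_ : - _ = \pi_circle (- x)) ?cnorm_le // !piE.
Qed.

Lemma cnormD s t : cnorm (s + t) <= cnorm s + cnorm t.
Proof.
have [x <- ->] := cnormP s; have [y <- ->] := cnormP t.
apply: le_trans (ler_normD x y).
by rewrite (_ : _ + _ = \pi_circle (x + y)) ?cnorm_le // !piE.
Qed.

Lemma cnorm0 : cnorm 0 = 0.
Proof.
have [n] := cnorm_pi_min 0; have := cnorm_pi_le 0 0.
rewrite subr0 normr0 (_ : \pi_circle 0 = 0) ?piE // => le0 h.
by apply/le_anti; rewrite le0 h normr_ge0.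
Qed.

Lemma cnorm_eq0 t : cnorm t = 0 -> t = 0.
Proof.
by have [x <- ->] := cnormP t => /eqP; rewrite normr_eq0 => /eqP->; rewrite piE.
Qed.

Definition cdist s t : R := cnorm (s - t).

Let cdistxx t : cdist t t = 0. Proof. by rewrite /cdist subrr cnorm0. Qed.

Let cdist_positivity s t : cdist s t = 0 -> s = t.
Proof. by move/cnorm_eq0/eqP; rewrite subr_eq0 => /eqP. Qed.

Let cdist_sym s t : cdist s t = cdist t s.
Proof. by rewrite /cdist -cnormN opprB. Qed.

Let cdist_triangle t s u : cdist s u <= cdist s t + cdist t u.
Proof. by rewrite /cdist -(subrKA t) cnormD. Qed.

HB.instance Definition _ :=
  isMetric.Build R circle cdistxx cdist_positivity cdist_sym cdist_triangle.

End Circle.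

Section FinitelySupported.
Variables (d : Order.disp_t) (K : orderType d).

Definition supp (z : K -> rat) : set K := [set xi | z xi != 0].

Definition rat_sum : set (K -> rat) := [set z | finite_set (supp z)].

Definition int_sum : set (K -> rat) :=
  [set z | finite_set (supp z) /\ forall xi, z xi \is a Num.int].

Definition unit_vec (xi : K) : K -> rat := fun eta => (eta == xi)%:R.

End FinitelySupported.

Section Independence.
Variable H : zmodType.

Definition torsion_free : Prop :=
  forall (x : H) (n : nat), (0 < n)%N -> x *+ n = 0 -> x = 0.

Definition independent (M : nat) (X : {fset H}) : Prop :=
  forall c : X -> int,
    \sum_(x : X) val x *~ c x = 0 -> (forall x, (`|c x| <= M)%N) ->
    forall x, c x = 0.

Definition mixed_relation (Q : nat) (A Y : {fset H})
    (b : A -> int) (c : Y -> int) : Prop :=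
  [/\ exists a, b a != 0, exists y, c y != 0,
      forall a, (`|b a| <= Q)%N, forall y, (`|c y| <= Q)%N
    & \sum_(a : A) val a *~ b a + \sum_(y : Y) val y *~ c y = 0].

End Independence.

Section Blocks.
Local Open Scope nat_scope.

(* [Ssum l] is the sum of the [Nblock j] for [j < l], see [SsumE]; unfolding it
   in [NblockE] gives the recursive definition of [Nblock]. *)
Fixpoint Ssum (l : nat) : nat :=
  if l is k.+1 then Ssum k + (k + 2) * (2 * k + 2 + Ssum k) else 0.

Definition Nblock (l : nat) : nat := (l + 2) * (2 * l + 2 + Ssum l).

Lemma SsumE l : Ssum l = \sum_(j < l) Nblock j.
Proof. by elim: l => [|l IH]; rewrite ?big_ord0 // big_ord_recr /= -IH. Qed.

Lemma NblockE l : Nblock l = (l + 2) * (2 * l + 2 + \sum_(j < l) Nblock j).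
Proof. by rewrite -SsumE. Qed.

Definition Rbound (l : nat) : nat := Ssum l + 2 * l + 2.

Definition Iblock (l : nat) : seq nat := iota (Ssum l) (Nblock l).

Variable R : realType.

Definition eps (l : nat) : R := (2 ^- (l + 6))%R.

Definition approximation_bound (q : nat -> R -> nat) : Prop :=
  forall l m : nat, 0 < m <= Rbound l + Nblock l ->
  forall (H : zmodType) (z : 'I_m -> H) (t : 'I_m -> circle R),
    (forall a : 'I_m -> int,
       (\sum_i z i *~ a i = 0)%R -> (forall i, `|a i| <= q m (eps l)) ->
       (\sum_i t i *~ a i = 0)%R) ->
    exists psi : {additive H -> circle R},
      forall i, (cnorm (psi (z i) - t i) < eps l)%R.

Definition Qbound (q : nat -> R -> nat) (l : nat) : nat :=
  maxn 1 (\max_(1 <= m < (Rbound l + Nblock l).+1) q m (eps l)).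

Definition independence_bound (q : nat -> R -> nat) (M : nat -> nat) : Prop :=
  forall (l : nat) (H : zmodType) (A X : {fset H}),
    torsion_free H -> #|` A| <= Rbound l -> independent (M l) X ->
    exists Y : {fset H},
      [/\ (Y `<=` X)%fset, #|` (X `\` Y)%fset| <= #|` A|
        & forall (b : A -> int) (c : Y -> int),
            ~ mixed_relation (Qbound q l) b c].

(* The filter of the sets of naturals whose relative density in the [l]-th
   block tends to 1 as [l] tends to infinity in [A]. *)
Definition density_filter (A : set nat) : set_system nat :=
  [set C | (fun l => (count (fun n => n \notin C) (Iblock l))%:R
                       / (Nblock l)%:R : R)%R @ within A \oo --> (0 : R)%R].

End Blocks.

Section Topology.
Variables (R : realType) (G : zmodType).

Definition Xblock (h : nat -> G) (g : G) (l : nat) : {fset G} :=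
  [fset h n - g | n in Iblock l]%fset.

Definition nonzero : Type := {x : G | x != 0}.

Definition Delta (psi : nonzero -> {additive G -> circle R}) (z : G) :
  {ptws nonzero -> circle R} := fun x => psi x z.

Definition tauG (psi : nonzero -> {additive G -> circle R}) : topologicalType :=
  initial_topology (Delta psi).

End Topology.

(* Main.v *)
Require Import Defs.
From HB Require Import structures.
From mathcomp Require Import all_boot all_order all_algebra finmap.
From mathcomp Require Import all_classical all_reals topology normedtype.
Import Order.TTheory GRing.Theory Num.Theory.
Import numFieldNormedType.Exports.

Local Open Scope classical_set_scope.
Local Open Scope card_scope.
Local Open Scope ring_scope.

(** The point [e (iota_ alpha)] is the limit of [h alpha] along [p alpha] in the
    topology [tauG], because convergence in an initial topology is convergence
    in every coordinate of [Delta psi], where it is [psi_lim]. So this point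
    lies in the closure of every set that contains the terms of the injective
    sequence [s alpha], [h alpha] being a subsequence of it ([closure_cvg]).

    Now an infinite set contains continuum many injective sequences, pairwise
    distinct: given one of them, a subset of the naturals can be recorded in
    the choice of one term from each of its successive pairs of terms
    ([infinite_card_inj_seq]). Each one is some [s alpha], different ones have
    different indices [alpha], and [e \o iota_] is injective; hence the closure
    contains continuum many of the points [e xi]. It cannot have more points
    than [G]. *)

Lemma card_le_inj {T U : Type} {B : set U} (f : T -> U) :
  injective f -> (forall x, B (f x)) -> [set: T] #<= B.
Proof.
move=> finj Bf; apply: card_le_trans (subset_card_le (_ : range f `<=` B)).
  by rewrite -(card_le_eql (inj_card_eq (in2W finj))) card_lexx.
by move=> _ [x _ <-].
Qed.

Lemma infinite_inj_seq {T : Type} (A : set T) :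
  infinite_set A -> exists2 a : nat -> T, injective a & forall n, A (a n).
Proof.
move=> /infiniteP/card_leP[f]; exists (fun n => val (f (to_setT n))) => [m n|n].
  by move=> /val_inj/inj fmn; apply: (congr1 val (fmn _ _)); rewrite inE.
exact: set_valP.
Qed.

Lemma infinite_card_inj_seq {T : Type} (A : set T) : infinite_set A ->
  [set: nat -> bool] #<= [set u : nat -> T | injective u /\ forall n, A (u n)].
Proof.
move=> /infinite_inj_seq[a ainj Aa].
apply: (card_le_inj (fun (b : nat -> bool) n => a (b n + n.*2)%N)) => [b c|b].
  move=> abc; apply/funext => n; have /ainj/addIn := congr1 (@^~ n) abc.
  by case: (b n) (c n) => [] [].
(* Halving [b n + n.*2] gives back [n], whatever [b] is. *)
split=> [m n /ainj/(congr1 half)|n]; last exact: Aa.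
by rewrite !half_bit_double.
Qed.

(** The product topology is the supremum of the initial topologies of the
    coordinate projections; these are onto, as constant functions show, so
    [cvg_image] applies to each of them. *)
Lemma cvg_ptws {I : Type} {V : topologicalType} (F : set_system (I -> V))
    (f : {ptws I -> V}) :
  Filter F -> (forall i, (fun g => g i) @ F --> f i) -> F --> f.
Proof.
move=> FF Ff; apply/cvg_sup => i; apply/cvg_image.
  by rewrite eqEsubset; split=> v // _; exists (cst v).
move=> W /Ff FW; exists (@^~ i @^-1` W) => //.
by rewrite eqEsubset; split=> [_ [? ? <-]//|v Wv]; exists (cst v).
Qed.

(** A basic neighbourhood of [x] is the preimage of a neighbourhood of [f x],
    so [f] may have any range. *)
Lemma cvg_initial {S : choiceType} {T : topologicalType} (f : S -> T)
    (F : set_system S) (x : S) :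
  Filter F -> f @ F --> f x -> F --> (x : initial_topology f).
Proof.
move=> FF Ff W /= [_ [[B Bop <-] Bfx] BW].
by apply: filterS BW _; apply: Ff; exact: open_nbhs_nbhs.
Qed.

Lemma closure_cvg {T : Type} {V : topologicalType} (F : set_system T)
    (u : T -> V) (A : set V) (l : V) :
  ProperFilter F -> (forall t, A (u t)) -> u @ F --> l -> closure A l.
Proof.
move=> FF Au; apply: closed_cvg (@closed_closure _ A) _ l.
by apply: nearW => t; exact/subset_closure/Au.
Qed.

Theorem proposition10p1
  (R : realType) (d : Order.disp_t) (K : orderType d)
  (K_continuum : continuum_ordinal K)
  (q : nat -> R -> nat) (M : nat -> nat)
  (q_bound : approximation_bound q)
  (M_bound : independence_bound q M)
  (* G, identified via j with a group between Z^(K) and Q^(K) *)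
  (G : zmodType)
  (G_torsion_free : torsion_free G)
  (G_card : [set: G] #= [set: nat -> bool])
  (j : {additive G -> (K -> rat)})
  (j_inj : injective j)
  (j_int : @int_sum d K `<=` range j)
  (j_rat : range j `<=` @rat_sum d K)
  (e : K -> G)
  (e_unit : forall xi, j (e xi) = unit_vec xi)
  (s : K -> nat -> G)
  (s_inj : injective s)
  (s_range : range s = [set u : nat -> G | injective u])
  (iota_ : K -> K)
  (iota_inj : injective iota_)
  (iota_supp : forall alpha,
     \bigcup_n supp (j (s alpha n)) `<=` [set xi | (xi < iota_ alpha)%O])
  (phi : K -> nat -> nat)
  (phi_incr : forall alpha, {homo phi alpha : m n / (m < n)%N})
  (h : K -> nat -> G)
  (h_def : forall alpha, h alpha = s alpha \o phi alpha)
  (X_card : forall alpha l,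
     #|` Xblock (h alpha) (e (iota_ alpha)) l|%fset = Nblock l)
  (X_indep : forall alpha l,
     independent (M l) (Xblock (h alpha) (e (iota_ alpha)) l))
  (h_supp : forall alpha n,
     supp (j (h alpha n)) `<=` [set xi | (xi < iota_ alpha)%O])
  (A_ : K -> set nat)
  (A_infinite : forall alpha, infinite_set (A_ alpha))
  (A_almost_disjoint : forall alpha beta,
     alpha <> beta -> finite_set (A_ alpha `&` A_ beta))
  (p : K -> set_system nat)
  (p_ultra : forall alpha, UltraFilter (p alpha))
  (p_density : forall alpha, density_filter R (A_ alpha) `<=` p alpha)
  (psi : nonzero G -> {additive G -> circle R})
  (psi_neq0 : forall x : nonzero G, psi x (val x) <> 0)
  (psi_lim : forall (x : nonzero G) alpha,
     (psi x \o h alpha) @ p alpha --> psi x (e (iota_ alpha))) :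
  (forall A : set (tauG psi),
     infinite_set A -> closure A #= [set: nat -> bool]) /\
  (forall A : set (tauG psi),
     infinite_set A -> closed A -> A #= [set: nat -> bool]).
Proof.
have e_inj : injective e.
  move=> xi eta /(congr1 j); rewrite !e_unit => /(congr1 (@^~ xi)).
  rewrite /unit_vec eqxx; have [-> //|_ h10] := eqVneq xi eta.
  by case/eqP: (oner_neq0 rat).
have p_proper alpha : ProperFilter (p alpha) by exact: ultra_proper.
have tauG_lim alpha :
    h alpha @ p alpha --> (e (iota_ alpha) : tauG psi).
  by apply: cvg_initial; apply: cvg_ptws => x; exact: psi_lim.
have closure_card (A : set (tauG psi)) :
    infinite_set A -> closure A #= [set: nat -> bool].
  move=> Ainf; apply/card_eqPle; split.
    by rewrite -(card_le_eqr G_card) card_leT.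
  apply: card_le_trans (infinite_card_inj_seq _ Ainf) _.
  pose D := [set alpha | forall n, A (s alpha n)].
  apply: (@card_le_trans _ _ _ D).
    apply: card_le_trans (card_image_le s D); apply: subset_card_le.
    move=> u [uinj Au]; have [alpha _ su] : range s u by rewrite s_range.
    by exists alpha => //; rewrite /D /= su.
  have eD : (e \o iota_) @` D #= D.
    exact: inj_card_eq (in2W (inj_comp e_inj iota_inj)).
  rewrite -(card_le_eql eD); apply: subset_card_le => _ [alpha Aalpha <-].
  apply: (@closure_cvg _ (tauG psi) _ _ _ _ (p_proper alpha) _ (tauG_lim alpha)) => n.
  by rewrite h_def; exact: Aalpha.
split=> // A Ainf /closure_id clA.
by rewrite clA; exact: closure_card.
Qed.
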